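(* Let $\Lambda$ be a lattice in $\mathbb{R}^2$ and let $u=(u_1,u_2)$ and $v=(v_1,v_2)$ be a pair of consecutive minimal vectors in $\Lambda$ with $u_2,v_2\ge0$ and $v_2>u_2$. Let $(\varepsilon,x,y)\in\{-1,1\}\times U$ be the intrinsic coordinates of $(u,v)$. (a) At least one of the two vectors $u$ and $v$ is a Hermite vector of $\Lambda$. (b) $u$ is a Hermite vector and $v$ is not a Hermite vector if and only if $$x>\frac{2y+1}{y+2}.$$ Furthermore, if this inequality holds then $v$ and $v+u$ are consecutive minimal vectors.
   Context: For $u=(u_1,u_2)\in\mathbb{R}^2$ let $B(u)=\{(x_1,x_2)\in\mathbb{R}^2:|x_1|\le|u_1|,\ |x_2|\le|u_2|\}$. A nonzero vector $u$ of a lattice $\Lambda\subset\mathbb{R}^2$ is a minimal vector in $\Lambda$ if for every nonzero $v=(v_1,v_2)\in\Lambda$, $v\in B(u)$ implies $|v_1|=|u_1|$ and $|v_2|=|u_2|$. Two minimal vectors $u=(u_1,u_2)$ and $v=(v_1,v_2)$ are consecutive if $|u_2|<|v_2|$ and there is no minimal vector $w=(w_1,w_2)$ with $|u_2|<|w_2|<|v_2|$. Let $U=\,]0,1[^2\,\cup(\{0\}\times[0,\tfrac12])\cup([0,\tfrac12]\times\{0\})$. If $u,v$ are consecutive minimal vectors in $\Lambda$ with $u_2,v_2\ge 0$ and $v_2>u_2$, then $u_1\ne0$ and there are unique $\varepsilon\in\{-1,1\}$ and $(x,y)\in U$ such that $u=(\varepsilon|u_1|,\,v_2y)$ and $v=(-\varepsilon|u_1|x,\,v_2)$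 (when $u_2=0$ and $u_1v_1>0$, $u$ is first replaced by $-u$). The triple $(\varepsilon,x,y)$ is called the intrinsic coordinates of the pair $(u,v)$. A Hermite vector of $\Lambda$ is a vector of $\Lambda$ that is a shortest nonzero vector of $\Lambda$ for the Euclidean norm $|(x_1,x_2)|_t=\big(|tx_1|^2+|\tfrac1t x_2|^2\big)^{1/2}$ for some real $t>0$. *)

(* Defs.v *)
From HB Require Import structures.
From mathcomp Require Import all_boot all_order all_algebra.
From mathcomp Require Import all_classical all_reals.
From mathcomp Require Import zify ring lra.

Set Implicit Arguments.
Unset Strict Implicit.
Unset Printing Implicit Defensive.

Import Order.TTheory GRing.Theory Num.Theory.

Local Open Scope classical_set_scope.
Local Open Scope ring_scope.

Section Definitions.
Variable R : realType.
Implicit Types (L : set (R * R)) (u v w : R * R).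

(* A lattice is the Z-span of a basis of R^2; the basis condition is det <> 0. *)
Definition is_lattice L : Prop :=
  exists a b : R * R, a.1 * b.2 - a.2 * b.1 != 0 /\
    L = [set w | exists m n : int, w = a *~ m + b *~ n].

Definition box u : set (R * R) :=
  [set x | `|x.1| <= `|u.1| /\ `|x.2| <= `|u.2|].

Definition minimal_vector L u : Prop :=
  [/\ L u, u != 0 &
      forall v, L v -> v != 0 -> box u v -> `|v.1| = `|u.1| /\ `|v.2| = `|u.2|].

Definition consecutive L u v : Prop :=
  [/\ minimal_vector L u, minimal_vector L v, `|u.2| < `|v.2| &
      ~ exists w, minimal_vector L w /\ `|u.2| < `|w.2| < `|v.2|].

Definition coord_domain : set (R * R) :=
  `]0, 1[ `*` `]0, 1[ `|` [set 0] `*` `[0, 2^-1] `|` `[0, 2^-1] `*` [set 0].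

(* If u.2 = 0 then u and - u are interchangeable, and the sign is chosen so that
   the first coordinates of u and v do not have the same sign. *)
Definition oriented u v : R * R :=
  if (u.2 == 0) && (0 < u.1 * v.1) then - u else u.

Definition intrinsic_coordinates u v (c : R * R * R) : Prop :=
  let: (e, x, y) := c in
  [/\ [set -1; 1] e, coord_domain (x, y),
      oriented u v = (e * `|u.1|, v.2 * y) & v = (- e * `|u.1| * x, v.2)].

Definition normt (t : R) (x : R * R) : R :=
  Num.sqrt (`|t * x.1| ^+ 2 + `|t^-1 * x.2| ^+ 2).

Definition hermite_vector L u : Prop :=
  exists t : R, [/\ 0 < t, L u, u != 0 &
    forall w, L w -> w != 0 -> normt t u <= normt t w].

Lemma fst_mulz u (m : int) : (u *~ m).1 = u.1 * m%:~R.
Proof. by rewrite (raddfMz (@fst R R)) /= mulrzr. Qed.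
Lemma snd_mulz u (m : int) : (u *~ m).2 = u.2 * m%:~R.
Proof. by rewrite (raddfMz (@snd R R)) /= mulrzr. Qed.

Lemma latticeB L u v : is_lattice L -> L u -> L v -> L (u - v).
Proof.
move=> [a [b [_ ->]]] [m [n ->]] [p [q ->]]; exists (m - p), (n - q).
by rewrite !mulrzBr opprD addrACA.
Qed.

Lemma pair_eq0 u : (u == 0) = (u.1 == 0) && (u.2 == 0).
Proof. by case: u. Qed.

Lemma bounded_coord (d x c1 c2 w1 w2 z1 z2 : R) : d != 0 -> x * d = z1 * c2 - z2 * c1 ->
  `|z1| <= w1 -> `|z2| <= w2 -> `|x| <= (w1 * `|c2| + w2 * `|c1|) / `|d|.
Proof.
move=> d0 E h1 h2; rewrite ler_pdivlMr ?normr_gt0 // -normrM E.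
apply: (le_trans (ler_normB _ _)); rewrite !normrM.
by apply: lerD; apply: ler_wpM2r.
Qed.

Lemma ltr_normD_opp (p q : R) : p * q <= 0 -> `|p| / 2 < `|q| -> `|q| < `|p| -> `|q + p| < `|q|.
Proof.
have [hp|hp|->] := ltrgt0P p; last by rewrite mul0r; lra.
  by rewrite pmulr_rle0 // => hq; rewrite (ler0_norm hq) => h1 h2; rewrite ltr_norml; apply/andP; split; lra.
by rewrite nmulr_rle0 // => hq; rewrite (ger0_norm hq) => h1 h2; rewrite ltr_norml; apply/andP; split; lra.
Qed.

Lemma minimal_below L w : is_lattice L -> L w -> w != 0 ->
  exists2 z, minimal_vector L z & box w z.
Proof.
move=> Llat Lw w0; have [a [b [d0 EL]]] := Llat.
set d := _ - _ in d0.
pose M1 := (`|w.1| * `|b.2| + `|w.2| * `|b.1|) / `|d|.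
pose M2 := (`|w.1| * `|a.2| + `|w.2| * `|a.1|) / `|d|.
have M10 : 0 <= M1 by rewrite divr_ge0 ?addr_ge0 ?mulr_ge0.
have M20 : 0 <= M2 by rewrite divr_ge0 ?addr_ge0 ?mulr_ge0.
pose N := Num.bound (M1 + M2).
have NP : M1 + M2 < N%:R by apply: archi_boundP; apply: addr_ge0.
pose p (i : 'I_(2 * N).+1 * 'I_(2 * N).+1) : R * R :=
  a *~ (i.1%:Z - N%:Z) + b *~ (i.2%:Z - N%:Z).
have pL i : L (p i) by rewrite EL; exists (i.1%:Z - N%:Z), (i.2%:Z - N%:Z).
have idx (m : int) : `|m%:~R : R| < N%:R -> exists i : 'I_(2 * N).+1, m = i%:Z - N%:Z.
  rewrite -intr_norm pmulrn ltr_int => h.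
  have h1 : (absz (m + N%:Z)%R < (2 * N).+1)%N by lia.
  by exists (Ordinal h1); rewrite /=; lia.
have surj z : L z -> box w z -> exists i, z = p i.
  rewrite EL => -[m [n Ez]] [h1 h2].
  have E1 : z.1 = a.1 * m%:~R + b.1 * n%:~R by rewrite Ez /= fst_mulz fst_mulz.
  have E2 : z.2 = a.2 * m%:~R + b.2 * n%:~R by rewrite Ez /= snd_mulz snd_mulz.
  have [|i Ei] := idx m.
    apply: le_lt_trans NP; apply: (@le_trans _ _ M1); last by rewrite lerDl.
    apply: bounded_coord d0 _ h1 h2; rewrite E1 E2 /d; ring.
  have [|j Ej] := idx n.
    apply: le_lt_trans NP; apply: (@le_trans _ _ M2); last by rewrite lerDr.
    rewrite -normrN; apply: bounded_coord d0 _ h1 h2; rewrite E1 E2 /d; ring.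
  by exists (i, j); rewrite /p /= -Ei -Ej.
have [i0 Ei0] := surj w Lw (conj (lexx _) (lexx _)).
pose P i := [&& p i != 0, `|(p i).1| <= `|w.1| & `|(p i).2| <= `|w.2|].
have P0 : P i0 by rewrite /P -Ei0 w0 !lexx.
case: (@Order.TotalTheory.arg_minP _ _ _ i0 P (fun i => `|(p i).1| + `|(p i).2|) P0) => i /and3P[pi0 h1 h2] mini.
exists (p i); last by split.
split => // v Lv v0 [k1 k2].
have bv : box w v by split; [apply: le_trans k1 h1|apply: le_trans k2 h2].
have [j Ej] := surj v Lv bv.
have := mini j; rewrite /P -Ej v0 /= (bv.1) (bv.2) => /(_ isT) h.
by split; lra.
Qed.

Lemma box_empty L u v w : is_lattice L -> consecutive L u v -> L w -> w != 0 ->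
  `|w.1| < `|u.1| -> `|w.2| < `|v.2| -> False.
Proof.
move=> Ll [mu mv luv nc] Lw w0 h1 h2.
have [z mz [k1 k2]] := minimal_below Ll Lw w0.
apply: nc; exists z; split=> //; rewrite (le_lt_trans k2 h2) andbT ltNge.
apply/negP => h3; case: mu => _ _ /(_ z).
case: mz => Lz z0 _ /(_ Lz z0 (conj (le_trans k1 (ltW h1)) h3)) [E _].
by move: (le_lt_trans k1 h1); rewrite E ltxx.
Qed.

(* The intrinsic coordinates of a pair of consecutive minimal vectors
   are well defined, so that a statement quantified over all triples satisfying
   [intrinsic_coordinates u v] is a statement about exactly one triple. *)
Lemma intrinsic_coordinates_exist_unique L u v : is_lattice L -> consecutive L u v ->
  0 <= u.2 -> 0 <= v.2 -> u.2 < v.2 -> exists! c, intrinsic_coordinates u v c.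
Proof.
move=> Ll cuv u20 v20 luv; have [mu mv _ _] := cuv.
case: (mu) => Lu u0 minu; case: (mv) => Lv v0 minv.
have v2p : 0 < v.2 by lra.
have Ev2 : `|v.2| = v.2 by rewrite ger0_norm.
have Eu2 : `|u.2| = u.2 by rewrite ger0_norm.
have hv1 : `|v.1| < `|u.1|.
  rewrite ltNge; apply/negP => h; have [|_] := minv u Lu u0.
    by split=> //; rewrite Ev2 Eu2 ltW.
  by rewrite Ev2 Eu2; lra.
have u1p : 0 < `|u.1| by apply: le_lt_trans hv1.
set u' := oriented u v.
have [Lu' u'1 u'2 ou'] : [/\ L u', `|u'.1| = `|u.1|, u'.2 = u.2 & (u.2 = 0 -> u'.1 * v.1 <= 0)].
  rewrite /u' /oriented; case: ifP => [/andP[/eqP E h]|/negbT].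
    have L0 : L 0 by rewrite -(subrr u); exact: latticeB.
    have LN : L (- u) by rewrite -[- u]sub0r; exact: latticeB.
    split=> [//| | |_]; first by rewrite normrN.
      by rewrite /= E oppr0.
    by rewrite /= mulNr; lra.
  by rewrite negb_and => /orP h; split=> // E; case: h; rewrite ?E ?eqxx // -leNgt.
have bu w : L w -> w != 0 -> `|w.1| <= `|u.1| -> `|w.2| < u.2 -> False.
  move=> Lw w0 h1 h2; have [|_ E] := minu w Lw w0; last by lra.
  by split=> //; rewrite Eu2 ltW.
have sgn : u'.1 * v.1 <= 0.
  have [E|u2n] := eqVneq u.2 0; first exact: ou'.
  rewrite leNgt; apply/negP => h.
  apply: (@box_empty L u v (v - u')) => //.
  - exact: latticeB.
  - by rewrite pair_eq0 /= u'2 negb_and; apply/orP; right; apply: lt0r_neq0; lra.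
  - have -> : (v - u').1 = v.1 - u'.1 by [].
    rewrite -u'1; move: hv1; rewrite -u'1.
    move: h; have [h1|h1|->] := ltrgt0P v.1; last by rewrite mulr0 ltxx.
      rewrite pmulr_lgt0 // => h2; rewrite (gtr0_norm h2) => h3.
      by rewrite ltr_norml; apply/andP; split; lra.
    rewrite nmulr_lgt0 // => h2; rewrite (ltr0_norm h2) => h3.
    by rewrite ltr_norml; apply/andP; split; lra.
  - by rewrite /= u'2 Ev2 ger0_norm; lra.
have B1 : v.1 = 0 -> u.2 <= v.2 / 2.
  move=> E; rewrite leNgt; apply/negP => h.
  apply: (bu (v - u')).
  - exact: latticeB.
  - by rewrite pair_eq0 /= u'2 negb_and; apply/orP; right; apply: lt0r_neq0; lra.
  - by rewrite /= E sub0r normrN u'1.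
  - by rewrite /= u'2 ger0_norm; lra.
have B2 : u.2 = 0 -> `|v.1| <= `|u.1| / 2.
  move=> E; rewrite leNgt; apply/negP => h.
  have lt1 : `|(v + u').1| < `|v.1| by apply: ltr_normD_opp; rewrite ?u'1.
  have [|||E1 _] := minv (v + u').
  - rewrite -[u']opprK -[- u']sub0r; apply: latticeB => //; apply: latticeB => //.
    by rewrite -(subrr u); exact: latticeB.
  - by rewrite pair_eq0 /= u'2 negb_and; apply/orP; right; apply: lt0r_neq0; lra.
  - by split; [exact: ltW|rewrite /= u'2 E addr0].
  - by rewrite E1 ltxx in lt1.
pose e := Num.sg u'.1.
have u'1n : u'.1 != 0 by rewrite -normr_gt0 u'1.
have Ee : u'.1 = e * `|u.1| by rewrite /e -u'1 -numEsg.
have e2 : e = -1 \/ e = 1.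
  by rewrite /e; case: (ltrgt0P u'.1) u'1n => [? _|? _|-> //]; rewrite ?eqxx //; [right; rewrite gtr0_sg|left; rewrite ltr0_sg].
exists (e, `|v.1| / `|u.1|, u.2 / v.2); split.
  rewrite /intrinsic_coordinates; split.
  - by case: e2 => ->; [left|right].
  - have h1 : `|v.1| / `|u.1| < 1 by rewrite ltr_pdivrMr // mul1r.
    have h2 : u.2 / v.2 < 1 by rewrite ltr_pdivrMr // mul1r.
    have p1 : 0 <= `|v.1| / `|u.1| by rewrite divr_ge0.
    have p2 : 0 <= u.2 / v.2 by rewrite divr_ge0.
    rewrite /coord_domain /=.
    have [E|n1] := eqVneq v.1 0.
      left; right; split=> /=; first by rewrite E normr0 mul0r.
      by rewrite in_itv /= p2 ler_pdivrMr // mulrC; exact: B1.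
    have [E|n2] := eqVneq u.2 0.
      right; split=> /=; last by rewrite E mul0r.
      by rewrite in_itv /= p1 ler_pdivrMr // mulrC; exact: B2.
    left; left; split=> /=; rewrite in_itv /=.
      by rewrite h1 andbT; apply: divr_gt0 => //; rewrite normr_gt0.
    by rewrite h2 andbT divr_gt0 // lt_neqAle eq_sym n2.
  - rewrite -/u' (surjective_pairing u') -Ee u'2; congr (_, _).
    by rewrite mulrC divfK // gt_eqF.
  - rewrite {1}(surjective_pairing v); congr (_, _).
    have He : e * `|v.1| = - v.1.
      move: sgn; rewrite Ee; case: e2 => ->.
        by rewrite !mulN1r mulNr oppr_le0 pmulr_rge0 // => h; rewrite ger0_norm.
      by rewrite !mul1r pmulr_rle0 // => h; rewrite ler0_norm.
    have u1n : `|u.1| != 0 by rewrite gt_eqF.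
    have -> : - e * `|u.1| * (`|v.1| / `|u.1|) = - (e * `|v.1|) by field.
    by rewrite He opprK.
move=> [[f x] y] [fs Ux Ev Eu].
have Eu1 : u'.1 = f * `|u.1| by rewrite /u' Ev.
have Eu2' : u.2 = v.2 * y by rewrite -u'2 /u' Ev.
have Ev1 : v.1 = - f * `|u.1| * x by rewrite Eu.
have ef : e = f.
  by apply: (mulIf (x := `|u.1|)); rewrite ?gt_eqF // -Ee.
have x0 : 0 <= x.
  case: Ux => [[[/=]|[/= -> //]]|[/=]]; rewrite in_itv /= => /andP[h _] _ //.
  exact: ltW.
congr (_, _, _) => //.
  have nf : `|f| = 1 by case: fs => /= ->; rewrite ?normrN normr1.
  by rewrite Ev1 !normrM normrN nf mul1r normr_id (ger0_norm x0) mulrAC mulfV ?mul1r // gt_eqF.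
by rewrite Eu2' mulrAC mulfV ?mul1r // gt_eqF.
Qed.

End Definitions.

(* Main.v *)
Require Import Defs.
From mathcomp Require Import all_boot all_order all_algebra.
From mathcomp Require Import all_classical all_reals.
From mathcomp Require Import zify ring lra.

Import Order.TTheory GRing.Theory Num.Theory.

Local Open Scope classical_set_scope.
Local Open Scope ring_scope.

(** Two consecutive minimal vectors generate the lattice: every point can be
    reduced modulo [u] and [v] to coefficients of absolute value at most 1/2,
    and such a remainder lies in the open box spanned by [u.1] and [v.2], which
    contains no nonzero lattice point ([lattice_adapted]).  After rescaling
    the axes, the lattice is therefore spanned by (1, y) and (-x, 1), and up to
    a constant factor the squared norm attached to [t] is

      q_s(m, n) = s (m - n x)^2 + (m y + n)^2,

    where s > 0 is arbitrary since t is ([hermite_adaptedP]).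

    The vector v, of coordinates (0, 1), can be beaten by (1, 0) and (1, 1).
    The first one is strictly shorter when s (1 - x^2) < 1 - y^2, the second one
    when s (2 x - 1) > y^2 + 2 y.  These two ranges of s cover everything as
    soon as (1 - y^2) (2 x - 1) > (y^2 + 2 y) (1 - x^2), and the difference of
    the two sides factors as (x (y + 2) - (2 y + 1)) (x y + 1); this is the
    source of the threshold (2 y + 1) / (y + 2), beyond which v is not a Hermite
    vector ([not_hermite_v_adapted]).

    Conversely, a vector of a basis is shortest as soon as the form is
    Lagrange-Gauss reduced in that basis ([reduced_form_min]).
    Up to the threshold, a suitable s makes the form reduced with v shortest
    ([hermite_v_adapted]).  Beyond it, y <= x, and the s for which u and v are
    orthogonal makes u shortest ([hermite_u_adapted]).  Hence one of u and v is
    always a Hermite vector, and u alone is one exactly beyond the threshold.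

    Finally x > 1/2 beyond the threshold.  In the strip of points whose first
    coordinate is smaller than that of v, the coefficients m and n of a nonzero
    point have the same strict sign ([narrow_strip_signs]), so that its second
    coordinate is at least that of v + u.  As x > 1/2 puts v + u itself inside
    the strip, v + u is the minimal vector that follows v
    ([adapted_consecutive_add]). *)

(** * Coordinates adapted to a pair of consecutive minimal vectors *)

(** The combination with coefficients m and n of the basis (a, b y), (-a x, b),
    which is the oriented pair when x and y are its intrinsic coordinates,
    b = v.2 and a is the signed first coordinate of the oriented u. *)
Definition adapted_point {R : realType} (a b x y : R) (m n : int) : R * R :=
  (a * (m%:~R - n%:~R * x), b * (m%:~R * y + n%:~R)).

Definition adapted_lattice {R : realType} (a b x y : R) : set (R * R) :=
  [set w | exists m n : int, w = adapted_point a b x y m n].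

(** The squared norm of [adapted_point a b x y m n] for the parameter t, divided
    by (b / t)^2, with s = (t^2 a / b)^2. *)
Definition adapted_form {R : realType} (s x y : R) (m n : int) : R :=
  s * (m%:~R - n%:~R * x) ^+ 2 + (m%:~R * y + n%:~R) ^+ 2.

Lemma coord_domain_bounds {R : realType} {x y : R} : coord_domain (x, y) ->
  [/\ 0 <= x < 1, 0 <= y < 1, x = 0 -> y <= 2^-1 & y = 0 -> x <= 2^-1].
Proof.
case=> [[[/=]|[/= ->]]|[/=]]; rewrite ?in_itv /=.
- move=> /andP[x0 x1] /andP[y0 y1].
  split; [by rewrite (ltW x0) x1|by rewrite (ltW y0) y1|lra|lra].
- move=> /andP[y0 y1]; split; [lra|lra|by []|lra].
- move=> /andP[x0 x1] ->; split; [lra|lra|lra|by []].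
Qed.

Lemma adapted_point_eq0 {R : realType} (a b x y : R) (m n : int) :
  a != 0 -> b != 0 -> 0 <= x -> 0 <= y ->
  (adapted_point a b x y m n == 0) = (m == 0) && (n == 0).
Proof.
move=> a0 b0 x0 y0; apply/idP/idP; last first.
  by case/andP=> /eqP -> /eqP ->; rewrite pair_eq0 /= !mul0r subr0 addr0 !mulr0 eqxx.
rewrite pair_eq0 /= !mulf_eq0 (negPf a0) (negPf b0) /= => /andP[/eqP E1 /eqP E2].
have d0 : 1 + x * y != 0 by rewrite gt_eqF // ltr_wpDr // mulr_ge0.
have En : n%:~R = 0 :> R by apply: (mulIf d0); rewrite mul0r; nra.
have Em : m%:~R = 0 :> R by rewrite En in E1; lra.
by rewrite -(intr_eq0 R) Em -(intr_eq0 R n) En eqxx.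
Qed.

Lemma exists_nearest_int {R : realType} (r : R) : exists m : int, `|r - m%:~R| <= 2^-1.
Proof.
exists (Num.floor (r + 2^-1)).
have := floor_le (r + 2^-1); have := floorD1_gt (r + 2^-1).
by rewrite intrD ler_norml => h1 h2; apply/andP; split; lra.
Qed.

(** The emptiness of the open box spanned by [u.1] and [v.2] forces u and v to
    generate the lattice, rather than a sublattice of it: rounding both
    coefficients of w to the nearest integers leaves a remainder in that box,
    because x and y are smaller than 1. *)
Lemma lattice_adapted {R : realType} {L : set (R * R)} {u v : R * R} {e x y : R} :
  is_lattice L -> consecutive L u v -> 0 < v.2 ->
  intrinsic_coordinates u v (e, x, y) ->
  exists2 a : R, a != 0 &
    [/\ oriented u v = adapted_point a v.2 x y 1 0,
        v = adapted_point a v.2 x y 0 1 & L = adapted_lattice a v.2 x y].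
Proof.
move=> latL cuv v2_gt0 [e1 dom Eu Ev].
have [[Lu u0 minu] [Lv v0 minv] luv _] := cuv.
have [/andP[x0 x1] /andP[y0 y1] _ _] := coord_domain_bounds dom.
have ne : `|e| = 1 by case: e1 => /= ->; rewrite ?normrN normr1.
have u1_gt0 : 0 < `|u.1|.
  rewrite normr_gt0; apply/negP => /eqP u1_0.
  case: (minv u) => //; last by move=> _ E; rewrite E ltxx in luv.
  by split; [rewrite u1_0 normr0|exact: ltW].
set a := e * `|u.1| in Eu.
have na : `|a| = `|u.1| by rewrite /a normrM ne mul1r normr_id.
have a0 : a != 0 by rewrite -normr_gt0 na.
have Eu' : oriented u v = adapted_point a v.2 x y 1 0.
  by rewrite Eu /adapted_point; congr (_, _); ring.
have Ev' : v = adapted_point a v.2 x y 0 1.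
  by rewrite {1}Ev /adapted_point /a; congr (_, _); ring.
exists a => //; split=> //.
have L0 : L 0 by rewrite -(subrr u); exact: latticeB.
have LN w : L w -> L (- w) by move=> Lw; rewrite -sub0r; exact: latticeB.
have LD w z : L w -> L z -> L (w + z).
  by move=> Lw /LN Lz; rewrite -(opprK z); exact: latticeB.
have LM w (m : int) : L w -> L (w *~ m).
  move=> Lw; have LMn k : L (w *+ k) by elim: k => [|k IH] //; rewrite mulrS; exact: LD.
  by case: m => k; [exact: LMn|apply: LN; exact: LMn].
have Lu' : L (oriented u v) by rewrite /oriented; case: ifP => // _; exact: LN.
have LP m n : L (adapted_point a v.2 x y m n).
  have -> : adapted_point a v.2 x y m n = oriented u v *~ m + v *~ n.
    rewrite Eu' [in RHS]Ev' /adapted_point [LHS]surjective_pairing [RHS]surjective_pairing.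
    by congr (_, _); rewrite /= !(fst_mulz, snd_mulz) /=; ring.
  by apply: LD; apply: LM.
rewrite eqEsubset; split=> [w Lw|w [m [n ->]]]; last exact: LP.
have d_gt0 : 0 < 1 + x * y by rewrite ltr_wpDr // mulr_ge0.
(* Cramer's rule in the basis (1, y), (-x, 1), of determinant 1 + x y. *)
pose p := (w.1 / a + x * (w.2 / v.2)) / (1 + x * y).
pose q := (w.2 / v.2 - y * (w.1 / a)) / (1 + x * y).
have E1 : w.1 = a * (p - q * x).
  by rewrite /p /q; field; rewrite a0 !gt_eqF.
have E2 : w.2 = v.2 * (p * y + q).
  by rewrite /p /q; field; rewrite a0 !gt_eqF.
have [m hm] := exists_nearest_int p; have [n hn] := exists_nearest_int q.
exists m, n; apply/eqP; rewrite -subr_eq0; apply/negP => /negP nz.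
have Lr : L (w - adapted_point a v.2 x y m n) by apply: latticeB.
apply: (box_empty latL cuv Lr nz).
- have -> : (w - adapted_point a v.2 x y m n).1 =
      a * ((p - m%:~R) - (q - n%:~R) * x) by rewrite /= E1; ring.
  rewrite normrM na -[ltRHS]mulr1 ltr_pM2l //.
  apply: (le_lt_trans (ler_normB _ _)); rewrite normrM (ger0_norm x0); nra.
- have -> : (w - adapted_point a v.2 x y m n).2 =
      v.2 * ((p - m%:~R) * y + (q - n%:~R)) by rewrite /= E2; ring.
  rewrite normrM -[ltRHS]mulr1 ltr_pM2l ?normr_gt0 ?gt_eqF //.
  apply: (le_lt_trans (ler_normD _ _)); rewrite normrM (ger0_norm y0); nra.
Qed.

(** * Hermite vectors and reduced forms *)

(** Being a Hermite vector only depends on x and y: as t varies, the ratio of the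
    weights of the two squared coordinates takes all positive values. *)
Lemma hermite_adaptedP {R : realType} {a b x y : R} {p q : int} :
  a != 0 -> 0 < b -> 0 <= x -> 0 <= y -> (p != 0) || (q != 0) ->
  hermite_vector (adapted_lattice a b x y) (adapted_point a b x y p q) <->
  exists2 s : R, 0 < s & forall m n : int, (m != 0) || (n != 0) ->
    adapted_form s x y p q <= adapted_form s x y m n.
Proof.
move=> a0 b0 x0 y0 pq.
have bn : b != 0 by rewrite gt_eqF.
have nz m n : (adapted_point a b x y m n != 0) = (m != 0) || (n != 0).
  by rewrite adapted_point_eq0 // negb_and.
have cmp t m n m' n' : 0 < t ->
    (normt t (adapted_point a b x y m n) <= normt t (adapted_point a b x y m' n')) =
    (adapted_form ((t ^+ 2 * a / b) ^+ 2) x y m n <=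
     adapted_form ((t ^+ 2 * a / b) ^+ 2) x y m' n').
  move=> t0; have tn : t != 0 by rewrite gt_eqF.
  have E i j : `|t * (adapted_point a b x y i j).1| ^+ 2 +
      `|t^-1 * (adapted_point a b x y i j).2| ^+ 2 =
      (b / t) ^+ 2 * adapted_form ((t ^+ 2 * a / b) ^+ 2) x y i j.
    by rewrite !real_normK ?num_real // /adapted_form /=; field; rewrite tn bn.
  rewrite /normt !E ler_sqrt; last first.
    apply: mulr_ge0; first exact: sqr_ge0.
    by apply: addr_ge0; [apply: mulr_ge0|]; exact: sqr_ge0.
  by rewrite ler_pM2l // exprn_gt0 // divr_gt0.
split=> [[t [t0 _ _ min]]|[s s0 min]].
  exists ((t ^+ 2 * a / b) ^+ 2).
    have tn : t != 0 by rewrite gt_eqF.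
    by rewrite exprn_even_gt0 //= mulf_neq0 ?invr_neq0 // mulf_neq0 // expf_neq0.
  by move=> m n mn; rewrite -cmp //; apply: min; [exists m, n|rewrite nz].
(* The solution of (t^2 a / b)^2 = s. *)
pose t := Num.sqrt (Num.sqrt s * b / `|a|).
have t0 : 0 < t by rewrite sqrtr_gt0 divr_gt0 ?normr_gt0 // mulr_gt0 ?sqrtr_gt0.
have Es : (t ^+ 2 * a / b) ^+ 2 = s.
  have na0 : `|a| != 0 by rewrite normr_eq0.
  rewrite /t sqr_sqrtr; last by rewrite ltW // -sqrtr_gt0.
  rewrite -[in RHS](sqr_sqrtr (ltW s0)) !exprMn -(real_normK (num_real a)).
  by field; rewrite na0 bn.
exists t; split=> //; [by exists p, q|by rewrite nz|].
by move=> _ [m [n ->]]; rewrite nz => mn; rewrite cmp // Es; apply: min.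
Qed.

(** Lagrange-Gauss reduction: P, C, Q are the entries of the Gram matrix.  The form
    is bounded below by (m^2 + n^2 - |m n|) P, and m^2 + n^2 - |m n| is a positive
    integer. *)
Lemma reduced_form_min {R : realType} {P C Q : R} {m n : int} :
  P <= Q -> `|C| *+ 2 <= P -> (m != 0) || (n != 0) ->
  P <= m%:~R ^+ 2 * P + 2 * (m%:~R * n%:~R) * C + n%:~R ^+ 2 * Q.
Proof.
move=> PQ CP mn.
have P0 : 0 <= P by apply: le_trans CP; rewrite mulrn_wge0.
have h1 : 1 <= m%:~R ^+ 2 + n%:~R ^+ 2 - `|m%:~R * n%:~R| :> R.
  have : (1 : int) <= m ^+ 2 + n ^+ 2 - `|m * n|.
    have [?|?] := leP 0 (m * n); nia.
  by rewrite -(ler_int R) intrB intrD intr_norm !intrM.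
have h2 : - (`|m%:~R * n%:~R| * `|C|) <= m%:~R * n%:~R * C.
  by rewrite -normrM; have := ler_norm (- (m%:~R * n%:~R * C)); rewrite normrN; lra.
have h3 : n%:~R ^+ 2 * P <= n%:~R ^+ 2 * Q by apply: ler_wpM2l => //; exact: sqr_ge0.
have h4 : `|m%:~R * n%:~R : R| * (`|C| *+ 2) <= `|m%:~R * n%:~R : R| * P by apply: ler_wpM2l.
have h5 : 1 * P <= (m%:~R ^+ 2 + n%:~R ^+ 2 - `|m%:~R * n%:~R|) * P by apply: ler_wpM2r.
lra.
Qed.

Lemma hermite_u_of_reduced {R : realType} (a b x y s : R) :
  a != 0 -> 0 < b -> 0 <= x -> 0 <= y -> 0 < s ->
  s + y ^+ 2 <= s * x ^+ 2 + 1 -> `|y - s * x| *+ 2 <= s + y ^+ 2 ->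
  hermite_vector (adapted_lattice a b x y) (adapted_point a b x y 1 0).
Proof.
move=> a0 b0 x0 y0 s0 uv red; apply/hermite_adaptedP => //; exists s => // m n mn.
have := @reduced_form_min R _ _ _ m n uv red mn.
by rewrite /adapted_form; congr (_ <= _); ring.
Qed.

Lemma hermite_v_of_reduced {R : realType} (a b x y s : R) :
  a != 0 -> 0 < b -> 0 <= x -> 0 <= y -> 0 < s ->
  s * x ^+ 2 + 1 <= s + y ^+ 2 -> `|y - s * x| *+ 2 <= s * x ^+ 2 + 1 ->
  hermite_vector (adapted_lattice a b x y) (adapted_point a b x y 0 1).
Proof.
move=> a0 b0 x0 y0 s0 uv red; apply/hermite_adaptedP => //; exists s => // m n.
rewrite orbC => mn; have := @reduced_form_min R _ _ _ n m uv red mn.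
by rewrite /adapted_form; congr (_ <= _); ring.
Qed.

(** The choice of s depends on the position of x with respect to y.  If y <= x, the
    vectors u and v are given equal norms, and the form is then reduced exactly
    when x is at most the threshold.  If 0 < x < y, they are made orthogonal, and v
    is the shorter of the two.  If x = 0, they are given equal norms again,
    and the form is reduced because y <= 1/2 on this part of the boundary. *)
Lemma hermite_v_adapted {R : realType} {a b x y : R} :
  a != 0 -> 0 < b -> coord_domain (x, y) -> x * (y + 2) <= 2 * y + 1 ->
  hermite_vector (adapted_lattice a b x y) (adapted_point a b x y 0 1).
Proof.
move=> a0 b0 /coord_domain_bounds[/andP[x0 x1] /andP[y0 y1] dx _] xy.
have [yx|xy'] := leP y x.
  have dx2 : 0 < 1 - x ^+ 2 by nra.
  pose s := (1 - y ^+ 2) / (1 - x ^+ 2).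
  have Es : s * (1 - x ^+ 2) = 1 - y ^+ 2 by rewrite /s divfK // gt_eqF.
  have s1 : 1 <= s by rewrite /s ler_pdivlMr // mul1r; nra.
  have Enorm : s * x ^+ 2 + 1 = s + y ^+ 2 by lra.
  apply: (@hermite_v_of_reduced _ _ _ _ _ s) => //; first lra.
    by rewrite Enorm.
  have sx : x <= s * x by nra.
  rewrite Enorm ler0_norm; last lra.
  (* The factorisation behind the threshold (2 y + 1) / (y + 2). *)
  have F : (s + y ^+ 2 - (s * x - y) *+ 2) * (1 - x ^+ 2) =
      (2 * y + 1 - x * (y + 2)) * (x * y + 1).
    have -> : (s + y ^+ 2 - (s * x - y) *+ 2) * (1 - x ^+ 2) =
      s * (1 - x ^+ 2) * (1 - 2 * x) + (y ^+ 2 + 2 * y) * (1 - x ^+ 2) by ring.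
    by rewrite Es; ring.
  have : 0 <= (s + y ^+ 2 - (s * x - y) *+ 2) * (1 - x ^+ 2).
    by rewrite F mulr_ge0 ?subr_ge0 // addr_ge0 ?mulr_ge0.
  by rewrite pmulr_lge0 //; lra.
have [Ex|xn] := eqVneq x 0.
  have {}dx := dx Ex; rewrite Ex.
  apply: (@hermite_v_of_reduced _ _ _ _ _ (1 - y ^+ 2)) => //; first nra.
    by rewrite expr0n mulr0; lra.
  by rewrite expr0n !mulr0 subr0 ger0_norm // add0r -mulr_natl; lra.
have xp : 0 < x by rewrite lt_neqAle eq_sym xn.
have Es : y / x * x = y by rewrite divfK.
have s1 : 1 < y / x by rewrite ltr_pdivlMr // mul1r.
apply: (@hermite_v_of_reduced _ _ _ _ _ (y / x)) => //; first lra.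
  by rewrite expr2 mulrA Es; nra.
by rewrite Es subrr normr0 mul0rn addr_ge0 // mulr_ge0 ?sqr_ge0 //; lra.
Qed.

(** For s = y / x the vectors u and v are orthogonal, and y <= x makes u the
    shorter one. *)
Lemma hermite_u_adapted {R : realType} (a b x y : R) :
  a != 0 -> 0 < b -> 0 < y < 1 -> y <= x ->
  hermite_vector (adapted_lattice a b x y) (adapted_point a b x y 1 0).
Proof.
move=> a0 b0 /andP[y0 y1] yx; have xp : 0 < x by lra.
have Es : y / x * x = y by rewrite divfK // gt_eqF.
have sp : 0 < y / x by rewrite divr_gt0.
have s1 : y / x <= 1 by rewrite ler_pdivrMr // mul1r.
apply: (@hermite_u_of_reduced _ _ _ _ _ (y / x)) => //; try lra.
- by rewrite expr2 mulrA Es; nra.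
- by rewrite Es subrr normr0 mul0rn addr_ge0 ?sqr_ge0 // ltW.
Qed.

(** Whatever s is, u or u + v is strictly shorter than v. *)
Lemma not_hermite_v_adapted {R : realType} {a b x y : R} :
  a != 0 -> 0 < b -> 0 <= x < 1 -> 0 <= y < 1 -> 2 * y + 1 < x * (y + 2) ->
  ~ hermite_vector (adapted_lattice a b x y) (adapted_point a b x y 0 1).
Proof.
move=> a0 b0 /andP[x0 x1] /andP[y0 y1] xy /hermite_adaptedP [] // s s0 min.
have h1 := min 1 0 isT; have h2 := min 1 1 isT.
have {h1} h1 : 1 - y ^+ 2 <= s * (1 - x ^+ 2) by move: h1; rewrite /adapted_form; lra.
have {h2} h2 : s * (2 * x - 1) <= y ^+ 2 + 2 * y by move: h2; rewrite /adapted_form; lra.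
have x2 : 0 < 2 * x - 1 by nra.
have k1 : (1 - y ^+ 2) * (2 * x - 1) <= s * (1 - x ^+ 2) * (2 * x - 1).
  by apply: ler_wpM2r => //; exact: ltW.
have k2 : s * (2 * x - 1) * (1 - x ^+ 2) <= (y ^+ 2 + 2 * y) * (1 - x ^+ 2).
  by apply: ler_wpM2r => //; nra.
have F : 0 < (x * (y + 2) - (2 * y + 1)) * (x * y + 1).
  by rewrite mulr_gt0 ?subr_gt0 // ltr_wpDl // mulr_ge0.
lra.
Qed.

(** * The minimal vector that follows v *)

(** If m n <= 0, then |m - n x| = |m| + |n| x, which is at
    least x, being at least 1 when n = 0. *)
Lemma narrow_strip_signs {R : realType} {x : R} {m n : int} :
  0 < x < 1 -> (m != 0) || (n != 0) -> `|m%:~R - n%:~R * x| < x -> 0 < m * n.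
Proof.
move=> /andP[x0 x1] mn h; rewrite ltNge; apply/negP => mn0.
have {mn0} mn1 : [/\ 0 <= m, n <= 0 & 1 <= m - n] \/ [/\ m <= 0, 0 <= n & 1 <= n - m].
  move: mn0 mn; have [m0|m0|->] := ltrgt0P m.
  - by rewrite pmulr_rle0 // => *; left; split; lia.
  - by rewrite nmulr_rle0 // => *; right; split; lia.
  - by have [n0|n0] := leP 0 n => *; [right|left]; split; lia.
have toR (i j : int) : i <= j -> i%:~R <= j%:~R :> R by rewrite ler_int.
move: h; rewrite ltr_norml => /andP[h1 h2].
by case: mn1 => -[/toR a1 /toR a2 /toR]; rewrite intrB => a3; nra.
Qed.

(** A normalisation by central symmetry: m and n may be assumed positive. *)
Lemma narrow_strip_coords {R : realType} {x : R} (y : R) {m n : int} :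
  0 < x < 1 -> (m != 0) || (n != 0) -> `|m%:~R - n%:~R * x| < x ->
  exists M N : int, [/\ 1 <= M, 1 <= N,
    `|m%:~R - n%:~R * x| = `|M%:~R - N%:~R * x| &
    `|m%:~R * y + n%:~R| = `|M%:~R * y + N%:~R| ].
Proof.
move=> x01 mn h; have := narrow_strip_signs x01 mn h.
have [m0|m0|->] := ltrgt0P m; last by rewrite mul0r.
  by rewrite pmulr_rgt0 // => n0; exists m, n; split=> //; lia.
rewrite nmulr_rgt0 // => n0; exists (- m), (- n); split; try lia.
  by rewrite -normrN !intrN; congr `|_|; ring.
by rewrite -normrN !intrN; congr `|_|; ring.
Qed.

(** A nonzero point in the box of v + u is in the strip of first coordinate smaller
    than that of v, because 1 - x < x.  A minimal vector higher than v is there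
    too, since v would otherwise be in its box.  In the strip, both coefficients
    are at least 1 up to a common sign, hence the second coordinate is at least
    that of v + u. *)
Lemma adapted_consecutive_add {R : realType} {a b x y : R} :
  a != 0 -> 0 < b -> 0 < x < 1 -> 0 < y -> 2^-1 < x ->
  minimal_vector (adapted_lattice a b x y) (adapted_point a b x y 0 1) ->
  consecutive (adapted_lattice a b x y)
    (adapted_point a b x y 0 1) (adapted_point a b x y 1 1).
Proof.
move=> a0 b0 x01 y0 x2 minv; have /andP[xp x1] := x01.
have bn : b != 0 by rewrite gt_eqF.
have nz m n : (adapted_point a b x y m n != 0) = (m != 0) || (n != 0).
  by rewrite adapted_point_eq0 ?negb_and // ltW.
have n1 m n m' n' : (`|(adapted_point a b x y m n).1| <=
    `|(adapted_point a b x y m' n').1|) =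
    (`|m%:~R - n%:~R * x| <= `|m'%:~R - n'%:~R * x|).
  by rewrite /= !normrM ler_pM2l // normr_gt0.
have n2 m n m' n' : (`|(adapted_point a b x y m n).2| <=
    `|(adapted_point a b x y m' n').2|) =
    (`|m%:~R * y + n%:~R| <= `|m'%:~R * y + n'%:~R|).
  by rewrite /= !normrM ler_pM2l // normr_gt0.
have x1E : `|1 - 1 * x| = 1 - x by rewrite mul1r ger0_norm // subr_ge0 ltW.
have y1E : `|1 * y + 1| = y + 1 by rewrite mul1r ger0_norm // addr_ge0 // ltW.
have x0E : `|0 - 1 * x| = x by rewrite mul1r sub0r normrN gtr0_norm.
have y0E : `|0 * y + 1| = 1 by rewrite mul0r add0r normr1.
have pos (M N : int) : 1 <= M -> 1 <= N ->
    [/\ 1 <= M%:~R :> R, 1 <= N%:~R :> R & `|M%:~R * y + N%:~R| = M%:~R * y + N%:~R].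
  rewrite -(ler_int R) -(ler_int R _ N) => M1 N1; split=> //.
  by rewrite ger0_norm //; nra.
split=> //.
- split; [by exists 1, 1|by rewrite nz|].
  move=> _ [m [n ->]]; rewrite nz => mn [].
  rewrite n1 n2 x1E y1E => h1 h2.
  have [|M [N [M1 N1 E1 E2]]] := narrow_strip_coords y x01 mn; first lra.
  have [M1' N1' E3] := pos _ _ M1 N1.
  (* A coefficient at least 2 would put the point above v + u. *)
  have EM : M = 1.
    by apply/eqP; rewrite eq_le M1 andbT leNgt -lezD1 -(ler_int R) intrD; apply/negP; nra.
  have EN : N = 1.
    by apply/eqP; rewrite eq_le N1 andbT leNgt -lezD1 -(ler_int R) intrD; apply/negP; nra.
  by rewrite /= !normrM E1 E2 EM EN.
- by rewrite ltNge n2 y1E y0E -ltNge ltrDr.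
- case=> w [[[m [n ->]] wn minw]]; rewrite !ltNge !n2 y0E y1E -!ltNge => /andP[h1 h2].
  have vn : adapted_point a b x y 0 1 != 0 by rewrite nz.
  have Lv : adapted_lattice a b x y (adapted_point a b x y 0 1) by exists 0, 1.
  have h3 : `|m%:~R - n%:~R * x| < x.
    rewrite ltNge; apply/negP => h3; case: (minw _ Lv vn).
      by split; rewrite ?n1 ?n2 ?x0E ?y0E // ltW.
    move=> _ E2; have : `|(adapted_point a b x y m n).2| <=
      `|(adapted_point a b x y 0 1).2| by rewrite E2.
    by rewrite n2 y0E leNgt h1.
  rewrite nz in wn; have [M [N [M1 N1 _ E2]]] := narrow_strip_coords y x01 wn h3.
  have [M1' N1' E3] := pos _ _ M1 N1.
  by move: h2; rewrite E2 E3; apply/negP; rewrite -leNgt; nra.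
Qed.

Lemma hermite_vectorN {R : realType} {L : set (R * R)} {u : R * R} : is_lattice L ->
  hermite_vector L (- u) -> hermite_vector L u.
Proof.
move=> latL [t [t0 Lu u0 min]]; exists t.
have L0 : L 0 by rewrite -(subrr (- u)); exact: latticeB.
have Lu' : L u by rewrite -[u]opprK -sub0r; exact: latticeB.
split=> //; first by rewrite -oppr_eq0.
move=> w Lw w0; apply: le_trans (min w Lw w0).
by rewrite /normt /= !mulrN !normrN.
Qed.

(** * Hermite vectors among two consecutive minimal vectors *)

Theorem proposition14 (R : realType) (L : set (R * R)) (u v : R * R) (e x y : R)
    (latticeL : is_lattice L) (consec_uv : consecutive L u v)
    (u2_ge0 : 0 <= u.2) (v2_ge0 : 0 <= v.2) (lt_u2v2 : u.2 < v.2)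
    (coords : intrinsic_coordinates u v (e, x, y)) :
  [/\ hermite_vector L u \/ hermite_vector L v,
      hermite_vector L u /\ ~ hermite_vector L v <->
        x > (2 * y + 1) / (y + 2) &
      x > (2 * y + 1) / (y + 2) -> consecutive L v (v + u)].
Proof.
have v2_gt0 : 0 < v.2 by apply: le_lt_trans lt_u2v2.
have dom : coord_domain (x, y) by case: coords.
have [x01 y01 _ hy0] := coord_domain_bounds dom.
have /andP[x0 x1] := x01; have /andP[y0 y1] := y01.
have [a a0 [Eu Ev EL]] := lattice_adapted latticeL consec_uv v2_gt0 coords.
have y2 : 0 < y + 2 by rewrite ltr_wpDl.
rewrite ltr_pdivrMr //.
have hv : x * (y + 2) <= 2 * y + 1 -> hermite_vector L v.
  by move=> /(hermite_v_adapted a0 v2_gt0 dom); rewrite -EL -Ev.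
have nhv : 2 * y + 1 < x * (y + 2) -> ~ hermite_vector L v.
  by move=> /(not_hermite_v_adapted a0 v2_gt0 x01 y01); rewrite -EL -Ev.
(* On the part y = 0 of the boundary x is at most 1/2, the threshold at y = 0;
   so beyond the threshold u.2 is not 0, and u is its own orientation. *)
have yp : 2 * y + 1 < x * (y + 2) -> 0 < y.
  move=> lt; rewrite lt_neqAle y0 andbT; apply/eqP => E.
  by have := hy0 (esym E); move: lt; rewrite -E; lra.
have hu : 2 * y + 1 < x * (y + 2) -> hermite_vector L u.
  move=> lt; have h : hermite_vector L (oriented u v).
    rewrite EL Eu; apply: hermite_u_adapted => //; first by rewrite yp.
    by nra.
  by move: h; rewrite /oriented; case: ifP => // _; exact: hermite_vectorN.
split.
- by have [/hv|/hu] := leP (x * (y + 2)) (2 * y + 1); [right|left].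
- split=> [[_ nv]|lt]; last by split; [exact: hu|exact: nhv].
  by rewrite ltNge; apply/negP => /hv.
- move=> lt; have y_gt0 := yp lt.
  have u2 : u.2 != 0.
    have <- : (oriented u v).2 = u.2.
      by rewrite /oriented; case: ifP => // /andP[/eqP /= -> _]; rewrite oppr0.
    by rewrite Eu /= mul1r addr0 mulf_neq0 ?gt_eqF.
  have Eo : oriented u v = u by rewrite /oriented (negPf u2).
  have Evu : v + u = adapted_point a v.2 x y 1 1.
    rewrite -Eo Eu {1}Ev /adapted_point [LHS]surjective_pairing /=.
    by congr (_, _); ring.
  have x2 : 2^-1 < x by nra.
  have xp : 0 < x < 1 by rewrite x1 andbT; lra.
  have := adapted_consecutive_add a0 v2_gt0 xp y_gt0 x2.
  by rewrite -EL -Ev -Evu; apply; case: consec_uv.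
Qed.
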